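(* There are, up to isomorphism of hyperfields, exactly $27$ hyperfields of order $5$.
   Context: A hyperoperation on a set $S$ is a map $\boxplus: S\times S\to 2^S\setminus\{\varnothing\}$; for non-empty $A,B\subseteq S$ put $A\boxplus B=\bigcup_{a\in A,b\in B}(a\boxplus b)$ (singletons are identified with their elements). It is commutative if $a\boxplus b=b\boxplus a$, and associative if $a\boxplus(b\boxplus c)=(a\boxplus b)\boxplus c$ for all $a,b,c$. All hyperoperations are assumed commutative. A hypergroup $(G,\boxplus,0)$ is a set with an associative hyperoperation such that: (1) $0\boxplus x=\{x\}$ for all $x$; (2) for every $x$ there is a unique element $-x$ with $0\in x\boxplus(-x)$; (3) $x\in y\boxplus z$ if and only if $z\in x\boxplus(-y)$. A hyperring is a tuple $(R,\odot,\boxplus,1,0)$ such that $(R,\odot,1)$ is a commutative monoid, $(R,\boxplus,0)$ is a commutative hypergroup, $0\odot x=x\odot 0=0$ for all $x$, and $a\odot(x\boxplus y)=(a\odot x)\boxplus(a\odot y)$ and $(x\boxplus y)\odot a=(x\odot a)\boxplus(y\odot a)$ for all $a,x,y$ (where $a\odot A=\{a\odot s: s\in A\}$, and similarly for $A\odot a$). A hyperfield is a hyperring with $0\ne1$ in which every nonzero element has a multiplicative inverse. The order of a finite hyperfield is the cardinality of its underlying set. A homomorphism of hyperfields $f:\mathbb{F}\to\mathbb{L}$ is a map with $f(0)=0$, $f(1)=1$, $f(xy)=f(x)f(y)$ and $f(x\boxplus_{\mathbb{F}}y)\subseteq f(x)\boxplus_{\mathbb{L}}f(y)$ for all $x,y$.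 An isomorphism is a homomorphism having a two-sided inverse that is also a homomorphism. *)

(* Defs.v *)
From mathcomp Require Import all_boot.
From mathcomp Require Import boolp classical_sets functions cardinality.

Set Implicit Arguments.
Unset Strict Implicit.
Unset Printing Implicit Defensive.

Local Open Scope classical_set_scope.

Declare Scope hyper_scope.
Delimit Scope hyper_scope with H.
Local Open Scope hyper_scope.

Definition hyperadd_set (T : Type) (op : T -> T -> set T) (A B : set T) : set T :=
  \bigcup_(a in A) \bigcup_(b in B) op a b.

(* A hyperoperation is a [set T]-valued operation with nonempty values; here it
   is always commutative. The field [hadd_opp] says that [hopp x] is the unique
   element [y] such that [hzero] belongs to [hadd x y]. *)
Record hypergroup : Type := Hypergroup {
  hsort :> Type;
  hadd : hsort -> hsort -> set hsort;
  hzero : hsort;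
  hopp : hsort -> hsort;
  hadd_neq0 : forall x y, hadd x y !=set0;
  haddC : commutative hadd;
  haddA : forall a b c,
    hyperadd_set hadd [set a] (hadd b c) = hyperadd_set hadd (hadd a b) [set c];
  hadd0 : forall x, hadd hzero x = [set x];
  hadd_opp : forall x y, hadd x y hzero <-> y = hopp x;
  hadd_rev : forall x y z, hadd y z x <-> hadd x (hopp y) z
}.

Arguments hzero {h}.
Notation "x ⊞ y" := (hadd x y) (at level 50, left associativity) : hyper_scope.

Record hyperring : Type := Hyperring {
  hgroup :> hypergroup;
  hmul : hgroup -> hgroup -> hgroup;
  hone : hgroup;
  hmulA : associative hmul;
  hmulC : commutative hmul;
  hmul1 : left_id hone hmul;
  hmul0l : left_zero hzero hmul;
  hmul0r : right_zero hzero hmul;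
  hmulDr : forall a x y : hgroup,
    hmul a @` (x ⊞ y) = hmul a x ⊞ hmul a y;
  hmulDl : forall a x y : hgroup,
    hmul^~ a @` (x ⊞ y) = hmul x a ⊞ hmul y a
}.

Arguments hone {h}.
Notation "x ⊙ y" := (hmul x y) (at level 40, left associativity) : hyper_scope.

Record hyperfield : Type := Hyperfield {
  hring :> hyperring;
  hzero_neq_one : hzero <> hone :> hring;
  hmul_inv : forall x : hring, x <> hzero -> exists y : hring, x ⊙ y = hone
}.

Definition has_order (F : hyperfield) (n : nat) : Prop := ([set: F] #= `I_n)%card.

Record hyperfield_hom (F L : hyperfield) (f : F -> L) : Prop := HyperfieldHom {
  hom_zero : f hzero = hzero;
  hom_one : f hone = hone;
  hom_mul : forall x y : F, f (x ⊙ y) = f x ⊙ f y;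
  hom_add : forall x y : F, f @` (x ⊞ y) `<=` f x ⊞ f y
}.

Definition hyperfield_iso (F L : hyperfield) : Prop :=
  exists (f : F -> L) (g : L -> F),
    [/\ hyperfield_hom f, hyperfield_hom g, cancel f g & cancel g f].

(* Main.v *)
(** The nonzero elements of a hyperfield of order 5 form a group of order 4, cyclic
    or Klein. The hyperaddition is determined by [-1] and by the relation
    [0 ∈ a ⊞ b ⊞ c] on nonzero triples, which is symmetric and invariant under
    scaling. Up to these symmetries there are five triples: the [(1, 1, z)], and
    a single class of triples with distinct entries. So a hyperfield of order 5
    is one of 256 codes (group, [-1], five bits), hyperfields are isomorphic
    exactly when a group isomorphism identifies their codes, and it remains to test
    associativity on a finite list and to count isomorphism classes. *)
Require Import Defs.
From mathcomp Require Import all_boot perm.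
From mathcomp Require Import boolp classical_sets functions cardinality.

Local Open Scope classical_set_scope.
Local Open Scope hyper_scope.

(** * Codes and their isomorphism test *)

Definition elt := (bool * bool)%type.

(* [k = true] gives the cyclic group generated by [(true, false)], [k = false] the
   Klein group. *)
Definition gmul (k : bool) (x y : elt) : elt :=
  (x.1 (+) y.1, x.2 (+) y.2 (+) [&& k, x.1 & y.1]).

Definition gone : elt := (false, false).

(** With [x.1] as low bit and [x.2] as high bit, the cyclic law is addition modulo 4, where negation
    flips the high bit of odd elements; in the Klein group every element is its own inverse. *)
Definition ginv (k : bool) (x : elt) : elt := (x.1, x.2 (+) (k && x.1)).

(* The orbit of the triple [(1, x, y)] under permutation and scaling: [Some z] is
   the orbit of [(1, 1, z)], and [None] is the orbit of triples with distinct entries. *)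
Definition gcls (k : bool) (x y : elt) : option elt :=
  if x == gone then Some y else if y == gone then Some x
  else if x == y then Some (ginv k x) else None.

(* [neg] is the element [-1], and [rel] selects the orbits of triples [(a, b, c)] with
   [0 ∈ a ⊞ b ⊞ c]. *)
Record code := Code { cyc : bool; neg : elt; rel : option elt -> bool }.

(* [None] stands for the zero of the hyperfield. *)
Definition mmul (k : bool) (a b : option elt) : option elt :=
  if a is Some x then omap (gmul k x) b else None.

Definition mopp (c : code) : option elt -> option elt := omap (gmul (cyc c) (neg c)).

(* For [x], [y], [z] nonzero, [z ∈ x ⊞ y] iff [0 ∈ 1 ⊞ x^-1 y ⊞ (- x^-1 z)]. *)
Definition madd (c : code) (a b d : option elt) : bool :=
  match a, b with
  | None, _ => d == b
  | _, None => d == a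
  | Some x, Some y =>
    let k := cyc c in
    if d is Some z then
      rel c (gcls k (gmul k (ginv k x) y)
                    (gmul k (ginv k x) (gmul k (neg c) z)))
    else y == gmul k (neg c) x
  end.

Definition elts : seq elt :=
  [:: (false, false); (false, true); (true, false); (true, true)].

Definition oelts : seq (option elt) := None :: map Some elts.

(* Every homomorphism out of [gmul k] is the [span] of its values on the generators
   [(true, false)] and [(false, true)]. *)
Definition span (m : elt -> elt -> elt) (a b x : elt) : elt :=
  m (if x.1 then a else gone) (if x.2 then b else gone).

Definition is_iso (m m' : elt -> elt -> elt) (f : elt -> elt) : bool :=
  all (fun x => all (fun y =>
    (f (m x y) == m' (f x) (f y)) && ((f x == f y) ==> (x == y))) elts) elts.

Definition code_iso (c c' : code) (f : elt -> elt) : bool :=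
  [&& is_iso (gmul (cyc c)) (gmul (cyc c')) f, neg c' == f (neg c) &
      all (fun o => rel c' (omap f o) == rel c o) oelts].

Definition isomorphic (c c' : code) : bool :=
  has (fun a => has (fun b => code_iso c c' (span (gmul (cyc c')) a b)) elts) elts.

(* By scaling, associativity of [x ⊞ y ⊞ z] need only be tested at [y = 1]. *)
Definition consistent (c : code) : bool :=
  [&& gmul (cyc c) (neg c) (neg c) == gone,
      all (fun y => has (madd c (Some gone) (Some y)) oelts) elts &
      all (fun a => all (fun b => all (fun d =>
        has (fun u => madd c (Some gone) (Some b) u && madd c (Some a) u d) oelts
        == has (fun u => madd c (Some a) (Some gone) u && madd c u (Some b) d) oelts)
      oelts) elts) elts].

Definition code_of_bits (p : bool * elt * (bool * (elt * elt))) : code :=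
  Code p.1.1 p.1.2 (fun o =>
    match o with
    | None => p.2.1
    | Some (false, false) => p.2.2.1.1
    | Some (false, true) => p.2.2.1.2
    | Some (true, false) => p.2.2.2.1
    | Some (true, true) => p.2.2.2.2
    end).

Definition codes : seq code :=
  [seq code_of_bits p | p <-
    [seq (x, y) | x <- [seq (k, e) | k <- [:: false; true], e <- elts],
                  y <- [seq (b, z) | b <- [:: false; true],
                                     z <- [seq (u, v) | u <- elts, v <- elts]]]].

Definition classes : seq code :=
  foldr (fun c s => if has (isomorphic c) s then s else c :: s) [::]
        (filter consistent codes).

Lemma all_eltsP (P : elt -> bool) : reflect (forall x, P x) (all P elts).
Proof. by apply: (iffP allP) => [h x|h x _ //]; apply: h; case: x => [[] []]. Qed.

Lemma all_oeltsP (P : option elt -> bool) : reflect (forall o, P o) (all P oelts).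
Proof.
by apply: (iffP allP) => [h x|h x _ //]; apply: h; case: x => [[[] []]|].
Qed.

Lemma has_eltsP (P : elt -> bool) : reflect (exists x, P x) (has P elts).
Proof.
apply: (iffP hasP) => [[x _ px]|[x px]]; exists x => //.
by case: x {px} => [[] []].
Qed.

Lemma has_oeltsP (P : option elt -> bool) : reflect (exists o, P o) (has P oelts).
Proof.
apply: (iffP hasP) => [[x _ px]|[x px]]; exists x => //.
by case: x {px} => [[[] []]|].
Qed.

(** * Arithmetic of the two groups, with a zero adjoined *)

Lemma gmulA k : associative (gmul k).
Proof. by case: k => -[[] []] [[] []] [[] []]. Qed.

Lemma gmulC k : commutative (gmul k).
Proof. by case: k => -[[] []] [[] []]. Qed.

Lemma gmul1 k : left_id gone (gmul k).
Proof. by case: k => -[[] []]. Qed.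

Lemma gmulV k x : gmul k x (ginv k x) = gone.
Proof. by case: k x => -[[] []]. Qed.

Lemma gmulI k : right_injective (gmul k).
Proof. by case: k => -[[] []] [[] []] [[] []]. Qed.

Lemma mmulA k : associative (mmul k).
Proof. by move=> [x|] [y|] [z|] //=; rewrite gmulA. Qed.

Lemma mmulC k : commutative (mmul k).
Proof. by move=> [x|] [y|] //=; rewrite gmulC. Qed.

Lemma mmul1 k : left_id (Some gone) (mmul k).
Proof. by move=> [x|] //=; rewrite gmul1. Qed.

Lemma mmul0 k : left_zero None (mmul k).
Proof. by []. Qed.

Lemma mmul0r k : right_zero None (mmul k).
Proof. by case. Qed.

Lemma mmulV k a : a <> None -> exists b, mmul k a b = Some gone.
Proof. by case: a => // x _; exists (Some (ginv k x)); rewrite /= gmulV. Qed.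

Lemma mone_neq0 : None <> Some gone.
Proof. by []. Qed.

(** * Realisation of a code as a hyperfield *)

Definition hyperfield_axioms (c : code) : bool :=
  all (fun a => all (fun b => has (madd c a b) oelts && all (fun d =>
    [&& madd c a b d == madd c b a d,
        madd c b d a == madd c a (mopp c b) d,
        madd c a b None == (b == mopp c a) &
        all (fun u =>
          ((a != None) ==>
             (madd c b d u == madd c (mmul (cyc c) a b) (mmul (cyc c) a d)
                                     (mmul (cyc c) a u))) &&
          (has (fun v => madd c b d v && madd c a v u) oelts
           == has (fun v => madd c a b v && madd c v d u) oelts)) oelts])
    oelts) oelts) oelts.

Lemma hyperfield_axiomsP (c : code) : hyperfield_axioms c ->
  [/\ forall a b, exists d, madd c a b d,
      forall a b, madd c a b =1 madd c b a,
      forall a b d u, (exists v, madd c b d v && madd c a v u) <->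
                      (exists v, madd c a b v && madd c v d u),
      forall a b, madd c a b None = (b == mopp c a) &
      (forall a b d, madd c b d a = madd c a (mopp c b) d) /\
      (forall a b d u, a <> None -> madd c b d u =
         madd c (mmul (cyc c) a b) (mmul (cyc c) a d) (mmul (cyc c) a u))].
Proof.
move=> /all_oeltsP ax; have {}ax a b := all_oeltsP _ (ax a) b.
have ne a b : exists d, madd c a b d by case/andP: (ax a b) => /has_oeltsP.
have {}ax a b d := all_oeltsP _ (andP (ax a b)).2 d.
split=> //; last split.
- by move=> a b d; have /and4P[/eqP] := ax a b d.
- move=> a b d u; have /and4P[_ _ _ /all_oeltsP/(_ u)/andP[_ /eqP e]] := ax a b d.
  by split=> /has_oeltsP; [rewrite e|rewrite -e] => /has_oeltsP.
- by move=> a b; have /and4P[_ _ /eqP] := ax a b None.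
- by move=> a b d; have /and4P[_ /eqP] := ax a b d.
- move=> a b d u /eqP a0; have /and4P[_ _ _ /all_oeltsP/(_ u)/andP[+ _]] := ax a b d.
  by rewrite a0 => /eqP.
Qed.

Lemma hyperadd_set1l (T : Type) (op : T -> T -> set T) (a : T) (A : set T) d :
  hyperadd_set op [set a] A d <-> exists2 u, A u & op a u d.
Proof.
split=> [[_ -> [u Au aud]]|[u Au aud]]; first by exists u.
by exists a => //; exists u.
Qed.

Lemma hyperadd_set1r (T : Type) (op : T -> T -> set T) (a : T) (A : set T) d :
  hyperadd_set op A [set a] d <-> exists2 u, A u & op u a d.
Proof.
split=> [[u Au [_ -> aud]]|[u Au aud]]; first by exists u.
by exists u => //; exists a.
Qed.

(** Closed transparently so that the carrier and the hyperaddition of the model reduce to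
    [option elt] and [madd]; [model_presents] then holds with [id]. *)
Definition model_group (c : code) (hc : hyperfield_axioms c) : hypergroup.
Proof.
refine (@Hypergroup (option elt) (fun a b => [set d | madd c a b d]) None
  (mopp c) _ _ _ _ _ _); have [ne comm assoc opp [rev _]] := hyperfield_axiomsP c hc.
- exact: ne.
- by move=> a b; apply/seteqP; split=> d /=; rewrite comm.
- move=> a b d; apply/seteqP; split=> u.
    move=> /hyperadd_set1l[v /= bdv avu]; apply/hyperadd_set1r.
    have [|w /andP[? ?]] := (assoc a b d u).1; last by exists w.
    by exists v; rewrite bdv.
  move=> /hyperadd_set1r[v /= bdv avu]; apply/hyperadd_set1l.
  have [|w /andP[? ?]] := (assoc a b d u).2; last by exists w.
  by exists v; rewrite bdv.
- by move=> a; apply/seteqP; split=> d /= /eqP.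
- by move=> a b /=; rewrite opp; split=> /eqP.
- by move=> a b d /=; rewrite rev.
Defined.

(** For nonzero [a], scaling is invertible, so elementwise invariance gives equality of sets; for
    [a = None] both sides are [{0}] because hypersums are non-empty. *)
Lemma model_distr (c : code) (hc : hyperfield_axioms c) (a x y : option elt) :
  mmul (cyc c) a @` [set d | madd c x y d] =
  [set d | madd c (mmul (cyc c) a x) (mmul (cyc c) a y) d].
Proof.
have [ne _ _ _ [_ distr]] := hyperfield_axiomsP c hc.
case: a => [a|]; apply/seteqP; split=> d /=.
- by move=> [u xyu <-]; rewrite -(distr (Some a)).
- have <- : mmul (cyc c) (Some a) (mmul (cyc c) (Some (ginv (cyc c) a)) d) = d.
    by rewrite mmulA /= gmulV; apply: mmul1.
  by rewrite -(distr (Some a)) // => xyu; eexists; first exact: xyu.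
- by move=> [u _ <-].
- by move=> /eqP ->; have [u] := ne x y; exists u.
Qed.

Definition model_ring (c : code) (hc : hyperfield_axioms c) : hyperring.
Proof.
refine (@Hyperring (model_group c hc) (mmul (cyc c)) (Some gone)
  (@mmulA _) (@mmulC _) (@mmul1 _) (@mmul0 _) (@mmul0r _) (model_distr c hc) _).
move=> a x y; rewrite [mmul _ x a]mmulC [mmul _ y a]mmulC -[RHS](model_distr c hc).
by congr image; apply: funext => u; rewrite mmulC.
Defined.

Definition model (c : code) (hc : hyperfield_axioms c) : hyperfield :=
  @Hyperfield (model_ring c hc) mone_neq0 (@mmulV (cyc c)).

(** * Isomorphisms and presentations by codes *)

Lemma has_orderP (F : hyperfield) n :
  has_order F n <-> exists f : 'I_n -> F, bijective f.
Proof.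
split.
  move=> /card_set_bijP[f [fI /in2TT finj fs]].
  have fn x : f x < n by apply: fI.
  pose g x := Ordinal (fn x).
  have gb : bijective g.
    rewrite -setTT_bijective; split=> //; first by move=> x y _ _ [] /finj; apply.
    by move=> i _; have [x _ fx] := fs i (ltn_ord i); exists x => //; apply/val_inj.
  by have [h gh hg] := gb; exists h; exists g.
case=> f [g fg gf]; apply/card_set_bijP; exists (val \o g); split.
- by move=> x _ /=.
- by move=> x y _ _ /val_inj /(can_inj gf).
- by move=> i /= ltin; exists (f (Ordinal ltin)) => //=; rewrite fg.
Qed.

(** A homomorphism only gives an inclusion of hypersums; the inclusion for its inverse turns this
    into an equivalence. *)
Lemma hyperfield_isoP (F F' : hyperfield) : hyperfield_iso F F' <->
  exists h : F -> F', [/\ bijective h, h hzero = hzero, h hone = hone,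
    {morph h : x y / x ⊙ y} & forall x y z, (x ⊞ y) z <-> (h x ⊞ h y) (h z)].
Proof.
split=> [[f [g [[f0 f1 fM fD] [g0 g1 gM gD] fg gf]]]|[h [[g hg gh] h0 h1 hM hD]]].
  exists f; split=> //; first by exists g.
  move=> x y z; split=> [xyz|fxyz]; first by apply: fD; exists z.
  by rewrite -[x]fg -[y]fg -[z]fg; apply: gD; exists (f z).
exists h, g; split=> //; split=> //.
- by move=> x y _ [z xyz <-]; apply/hD.
- by rewrite -h0 hg.
- by rewrite -h1 hg.
- by move=> x y; apply: (can_inj hg); rewrite hM !gh.
- by move=> x y _ [z xyz <-]; apply/hD; rewrite !gh.
Qed.

(** The code is arbitrary here, so [F] can be compared with [c] before [c] is known to satisfy
    [hyperfield_axioms]. *)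
Record presents (F : hyperfield) (c : code) (phi : option elt -> F) : Prop := Presents {
  pres_bij : bijective phi;
  pres0 : phi None = hzero;
  pres1 : phi (Some gone) = hone;
  presM : {morph phi : a b / mmul (cyc c) a b >-> a ⊙ b};
  presD : forall a b d, madd c a b d <-> (phi a ⊞ phi b) (phi d)
}.

Lemma model_presents (c : code) (hc : hyperfield_axioms c) :
  presents (model c hc) c id.
Proof. by split=> //; exists id. Qed.

Lemma presents_order (F : hyperfield) c phi : presents F c phi -> has_order F 5.
Proof.
move=> [phib _ _ _ _]; apply/has_orderP.
have card5 : #|{: option elt}| = 5 by rewrite card_option card_prod card_bool.
exists (phi \o (enum_val \o cast_ord (esym card5))); apply: (bij_comp phib).
apply: bij_comp; first exact: enum_val_bij.
by apply: (Bijective (cast_ordK _) (cast_ordKV _)).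
Qed.

(** * Isomorphisms of codes against isomorphisms of hyperfields *)

Lemma is_isoP (m m' : elt -> elt -> elt) (f : elt -> elt) :
  reflect ({morph f : x y / m x y >-> m' x y} /\ injective f) (is_iso m m' f).
Proof.
apply: (iffP idP) => [/all_eltsP iso|[fM finj]].
  split=> x y; have /all_eltsP/(_ y)/andP[/eqP// _ /implyP fI] := iso x.
  by move=> fxy; apply/eqP/fI/eqP.
apply/all_eltsP => x; apply/all_eltsP => y.
by rewrite fM eqxx /=; apply/implyP => /eqP/finj ->.
Qed.

Lemma iso_gone (k k' : bool) (f : elt -> elt) :
  is_iso (gmul k) (gmul k') f -> f gone = gone.
Proof.
move=> /is_isoP[fM _]; apply: (@gmulI k' (f gone)).
by rewrite -fM gmul1 gmulC gmul1.
Qed.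

Lemma iso_ginv (k k' : bool) (f : elt -> elt) x :
  is_iso (gmul k) (gmul k') f -> f (ginv k x) = ginv k' (f x).
Proof.
move=> fiso; have /is_isoP[fM _] := fiso; apply: (@gmulI k' (f x)).
by rewrite -fM !gmulV (iso_gone _ _ _ fiso).
Qed.

Lemma iso_gcls (k k' : bool) (f : elt -> elt) x y :
  is_iso (gmul k) (gmul k') f -> gcls k' (f x) (f y) = omap f (gcls k x y).
Proof.
move=> fiso; have /is_isoP[fM finj] := fiso.
rewrite /gcls -(iso_ginv _ _ _ _ fiso) -{1 2}(iso_gone _ _ _ fiso) !(inj_eq finj).
by do 3 case: eqP => // _.
Qed.

Lemma code_iso_madd (c c' : code) (f : elt -> elt) a b d : code_iso c c' f ->
  madd c' (omap f a) (omap f b) (omap f d) = madd c a b d.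
Proof.
move=> /and3P[fiso /eqP fe /all_oeltsP frel]; have /is_isoP[fM finj] := fiso.
have oinj : injective (omap f) by apply: inj_omap.
case: a => [a|]; last exact: (inj_eq oinj d b).
case: b => [b|]; last exact: (inj_eq oinj d (Some a)).
case: d => [d|] /=; rewrite fe -?(iso_ginv _ _ _ _ fiso) -!fM ?(inj_eq finj) //.
by rewrite (iso_gcls _ _ _ _ _ fiso) (eqP (frel _)).
Qed.

Lemma isomorphic_hyperfield_iso (F F' : hyperfield) (c c' : code) phi phi' :
  presents F c phi -> presents F' c' phi' -> isomorphic c c' -> hyperfield_iso F F'.
Proof.
move=> [[psi phiK psiK] p0 p1 pM pD] [phi'b p0' p1' pM' pD'].
move=> /has_eltsP[x /has_eltsP[y]]; set f := span _ x y => fiso.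
have /and3P[giso _ _] := fiso; have /is_isoP[fM finj] := giso.
apply/hyperfield_isoP; exists (phi' \o omap f \o psi); split=> /=.
- apply: bij_comp; last by exists phi.
  by apply: bij_comp => //; apply: injF_bij; apply: inj_omap.
- by rewrite -p0 phiK /= p0'.
- by rewrite -p1 phiK /= (iso_gone _ _ _ giso) p1'.
- move=> u v /=; have -> : u ⊙ v = phi (mmul (cyc c) (psi u) (psi v)) by rewrite pM !psiK.
  by rewrite /= phiK -pM'; congr phi'; case: (psi u) (psi v) => [a|] [b|] //=; rewrite fM.
- move=> u v w; have := pD (psi u) (psi v) (psi w); rewrite !psiK => <-.
  by rewrite -pD' (code_iso_madd _ _ _ _ _ _ fiso).
Qed.

Lemma span_iso (k : bool) (m : elt -> elt -> elt) (f : elt -> elt) :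
  f gone = gone -> {morph f : x y / gmul k x y >-> m x y} ->
  f = span m (f (true, false)) (f (false, true)).
Proof.
move=> f1 fM; apply: funext => x.
have -> : x = gmul k (if x.1 then (true, false) else gone)
                     (if x.2 then (false, true) else gone).
  by case: k {fM} x => [] [[] []].
by rewrite fM; case: k {fM} x => [] [[] []] //=; rewrite /span /= f1.
Qed.

(** Reads the bits of the code off the hyperaddition, so that isomorphisms of hyperfields preserve
    them; the factor [ginv (cyc c) (neg c)] undoes the sign built into [madd]. *)
Lemma rel_madd (c : code) x y :
  rel c (gcls (cyc c) x y) =
  madd c (Some gone) (Some x) (Some (gmul (cyc c) (ginv (cyc c) (neg c)) y)).
Proof.
rewrite /madd (_ : ginv _ gone = gone); last by case: (cyc c).
by rewrite !gmul1 gmulA gmulV gmul1.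
Qed.

Lemma hyperfield_iso_isomorphic (F F' : hyperfield) (c c' : code) phi phi' :
  presents F c phi -> presents F' c' phi' -> hyperfield_iso F F' -> isomorphic c c'.
Proof.
move=> [phib p0 p1 pM pD] [[psi phiK psiK] p0' p1' pM' pD'].
move=> /hyperfield_isoP[h [hb h0 h1 hM hD]].
pose g a := psi (h (phi a)).
have gE a : phi' (g a) = h (phi a) by rewrite /g psiK.
have ginj : injective g.
  by move=> a b /(congr1 phi'); rewrite !gE => /(bij_inj hb)/(bij_inj phib).
have g0 : g None = None by rewrite /g p0 h0 -p0' phiK.
have g1 : g (Some gone) = Some gone by rewrite /g p1 h1 -p1' phiK.
have gM : {morph g : a b / mmul (cyc c) a b >-> mmul (cyc c') a b}.
  by move=> a b; rewrite /g pM hM -!gE -pM' !phiK.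
have gD a b d : madd c a b d = madd c' (g a) (g b) (g d).
  apply/idP/idP => [/pD/hD|abd]; first by rewrite -!gE => /pD'.
  by apply/pD/hD; rewrite -!gE; apply/pD'.
(* The default [gone] is never taken, since [g] is injective and fixes [None]. *)
pose f x := odflt gone (g (Some x)).
have fE x : g (Some x) = Some (f x).
  by rewrite /f; case E: (g _) => //; move: E; rewrite -g0 => /ginj.
have gf a : g a = omap f a by case: a => [x|] //=; rewrite ?g0 ?fE.
have f1 : f gone = gone by rewrite /f g1.
have fM : {morph f : x y / gmul (cyc c) x y >-> gmul (cyc c') x y}.
  by move=> x y; have := gM (Some x) (Some y); rewrite /= !fE => -[].
have finj : injective f by move=> x y fxy; apply: Some_inj; apply: ginj; rewrite !fE fxy.
have fiso : is_iso (gmul (cyc c)) (gmul (cyc c')) f by apply/is_isoP.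
(* The sign is recovered as the only element whose hypersum with 1 contains 0. *)
have fneg : neg c' = f (neg c).
  have := gD (Some gone) (Some (neg c)) None.
  by rewrite g1 g0 fE /madd gmulC gmul1 eqxx => /esym/eqP ->; rewrite gmulC gmul1.
apply/has_eltsP; exists (f (true, false)); apply/has_eltsP; exists (f (false, true)).
rewrite -(span_iso _ _ _ f1 fM); apply/and3P; split=> //; first exact/eqP.
have frel x y : rel c' (omap f (gcls (cyc c) x y)) = rel c (gcls (cyc c) x y).
  rewrite -(iso_gcls _ _ _ _ _ fiso) !rel_madd gD !gf /= f1 fM.
  by rewrite (iso_ginv _ _ _ _ fiso) fneg.
(* Every orbit is a value of [gcls]: [Some z] comes from [(1, 1, z)], and [None] from 1 with the two
   generators. *)
apply/all_oeltsP => -[z|]; apply/eqP.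
  exact: (frel gone z).
by have := frel (true, false) (false, true).
Qed.

(** * Groups of order four *)

Definition is_group_law (m : elt -> elt -> elt) : bool :=
  all (fun x => all (fun y => all (fun z =>
    (m x (m y z) == m (m x y) z) && ((m x y == m x z) ==> (y == z)))
  elts) elts) elts.

(** A commutative table with identity [gone] is given by six products of the other elements, taken
    in the order [(false, true)], [(true, false)], [(true, true)]. This leaves [4^6] tables to
    search. *)
Definition sym_law (aa ab ac bb bc cc : elt) (x y : elt) : elt :=
  match x, y with
  | (false, false), _ => y
  | _, (false, false) => x
  | (false, true), (false, true) => aa
  | (false, true), (true, false) | (true, false), (false, true) => ab
  | (false, true), (true, true) | (true, true), (false, true) => ac
  | (true, false), (true, false) => bb
  | (true, false), (true, true) | (true, true), (true, false) => bc
  | (true, true), (true, true) => cc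
  end.

Lemma sym_law_classification :
  all (fun aa => all (fun ab => all (fun ac => all (fun bb => all (fun bc => all (fun cc =>
    let m := sym_law aa ab ac bb bc cc in
    (* Unlike [==>], [if] spares [vm_compute] the search for non-groups. *)
    if is_group_law m then
      has (fun k => has (fun a => has (fun b => is_iso (gmul k) m (span m a b))
        elts) elts) [:: false; true]
    else true) elts) elts) elts) elts) elts) elts.
Proof. by vm_compute. Qed.

Lemma group_law_classification (m : elt -> elt -> elt) :
  left_id gone m -> commutative m -> associative m -> right_injective m ->
  exists (k : bool) (f : elt -> elt), is_iso (gmul k) m f.
Proof.
move=> m1 mC mA mI.
pose x := (false, true) : elt; pose y := (true, false) : elt; pose z := (true, true) : elt.
pose s := sym_law (m x x) (m x y) (m x z) (m y y) (m y z) (m z z).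
have ms : m = s.
  apply: funext => u; apply: funext => v.
  by case: u v => [[] []] [[] []]; rewrite ?m1 //= ?[m _ (false, false)]mC ?m1 // mC.
have gl : is_group_law s.
  rewrite -ms; apply/all_eltsP => u; apply/all_eltsP => v; apply/all_eltsP => w.
  by rewrite mA eqxx /=; apply/implyP => /eqP/mI ->.
have := sym_law_classification.
move=> /all_eltsP/(_ (m x x))/all_eltsP/(_ (m x y))/all_eltsP/(_ (m x z)).
move=> /all_eltsP/(_ (m y y))/all_eltsP/(_ (m y z))/all_eltsP/(_ (m z z)).
cbv zeta; rewrite -/s gl => /hasP[k _].
by move=> /has_eltsP[a /has_eltsP[b]]; rewrite ms; exists k, (span s a b).
Qed.

(** * Coding an arbitrary hyperfield of order 5 *)

Lemma pointed_enumeration (F : hyperfield) : has_order F 5 ->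
  exists h : option elt -> F, [/\ bijective h, h None = hzero & h (Some gone) = hone].
Proof.
move=> /has_orderP[f fb].
have card5 : #|{: option elt}| = 5 by rewrite card_option card_prod card_bool.
have [h hb] : exists h : option elt -> F, bijective h.
  exists (f \o (cast_ord card5 \o enum_rank)); apply: (bij_comp fb).
  apply: bij_comp; last exact: enum_rank_bij.
  by apply: (Bijective (cast_ordK _) (cast_ordKV _)).
have [h1 h1b h10] : exists2 h1 : option elt -> F, bijective h1 & h1 None = hzero.
  have [g hg gh] := hb; exists (h \o tperm None (g hzero)); last by rewrite /= tpermL.
  by apply: bij_comp => //; apply: injF_bij; apply: perm_inj.
(* This second transposition fixes [None], because 0 and 1 differ in [F]. *)
have [g hg gh] := h1b; exists (h1 \o tperm (Some gone) (g hone)); split.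
- by apply: bij_comp => //; apply: injF_bij; apply: perm_inj.
- rewrite /= tpermD //; apply/eqP => gN; apply: (@hzero_neq_one F).
  by rewrite -h10 -gN gh.
- by rewrite /= tpermL.
Qed.

Lemma hadd_mul2l (F : hyperfield) (u a b d : F) : u <> hzero ->
  (u ⊙ a ⊞ u ⊙ b) (u ⊙ d) <-> (a ⊞ b) d.
Proof.
move=> u0; split=> [|abd]; last by rewrite -hmulDr; exists d.
have [v uv] := hmul_inv u0.
have vK x : v ⊙ (u ⊙ x) = x by rewrite hmulA [v ⊙ u]hmulC uv hmul1.
move=> abd; rewrite -[a]vK -[b]vK -[d]vK -(hmulDr v (u ⊙ a) (u ⊙ b)).
by exists (u ⊙ d).
Qed.

(** Multiply [0 ∈ 1 ⊞ (-1)] by [x] and use uniqueness of opposites. *)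
Lemma hopp_mul (F : hyperfield) (x : F) : hopp x = hopp hone ⊙ x.
Proof.
apply/esym/hadd_opp; rewrite -[X in (X ⊞ _) _]hmul1 -hmulDl.
by exists hzero; [apply/hadd_opp|exact: hmul0l].
Qed.

Lemma hoppK (F : hyperfield) (x : F) : hopp (hopp x) = x.
Proof. by apply/esym/hadd_opp; rewrite haddC; apply/hadd_opp. Qed.

Lemma hadd_assoc (F : hyperfield) (a b d u : F) :
  (exists2 v, (b ⊞ d) v & (a ⊞ v) u) <-> (exists2 v, (a ⊞ b) v & (v ⊞ d) u).
Proof. by rewrite -hyperadd_set1l -hyperadd_set1r haddA. Qed.

(** This is [0 ∈ a ⊞ b ⊞ c], since [hopp c] is the only element whose hypersum with [c] contains
    0. *)
Definition zero_sum (F : hyperfield) (a b c : F) : Prop := (a ⊞ b) (hopp c).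

Lemma zero_sumC (F : hyperfield) (a b c : F) : zero_sum F a b c <-> zero_sum F b a c.
Proof. by rewrite /zero_sum haddC. Qed.

Lemma zero_sum_mul2l (F : hyperfield) (u a b c : F) : u <> hzero ->
  zero_sum F (u ⊙ a) (u ⊙ b) (u ⊙ c) <-> zero_sum F a b c.
Proof.
move=> u0; rewrite /zero_sum hopp_mul [hopp c]hopp_mul hmulA [hopp hone ⊙ u]hmulC.
by rewrite -hmulA hadd_mul2l.
Qed.

Lemma hopp1_neq0 (F : hyperfield) : hopp hone <> hzero :> F.
Proof.
move=> h; have : (hone ⊞ hopp hone) (hzero : F) by apply/hadd_opp.
by rewrite h haddC hadd0 => /hzero_neq_one.
Qed.

(** Reversibility moves [a] to the other side, and scaling by -1 clears the signs. With [zero_sumC]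
    this yields all permutations of the triple. *)
Lemma zero_sum_rot (F : hyperfield) (a b c : F) : zero_sum F a b c <-> zero_sum F c a b.
Proof.
rewrite /zero_sum hadd_rev -(hadd_mul2l F (hopp hone) c a); last exact: hopp1_neq0.
by rewrite -!hopp_mul hoppK.
Qed.

(** [T x y] stands for a property of the triple [(1, x, y)]: the first hypothesis swaps [x] and [y],
    the second divides by [x] and swaps the first two entries. These moves connect all triples of an
    orbit that start with 1. *)
Lemma gcls_invariant (k : bool) (T : elt -> elt -> bool) x y :
    (forall x y, T x y = T y x) ->
    (forall x y, T x y = T (ginv k x) (gmul k (ginv k x) y)) ->
  T x y = if gcls k x y is Some z then T gone z else T (true, false) (false, true).
Proof.
move=> Ts Ti; rewrite /gcls; case: eqP => [-> //|x1]; case: eqP => [->|y1].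
  exact: Ts.
case: eqP => [<-|xy]; first by rewrite Ti gmulC gmulV Ts.
(* These nine instances link the six pairs of distinct nonidentity elements, for either group. *)
have := Ti (true, false) (false, true); have := Ti (true, false) (true, true).
have := Ti (false, true) (true, false); have := Ti (false, true) (true, true).
have := Ti (true, true) (true, false); have := Ti (true, true) (false, true).
have := Ts (true, false) (false, true); have := Ts (true, false) (true, true).
have := Ts (false, true) (true, true).
by clear Ts Ti; case: k => /=; case: x y x1 y1 xy => [[] []] [[] []] //; cbv; congruence.
Qed.

Lemma hyperfield5_presented (F : hyperfield) : has_order F 5 ->
  exists (c : code) (phi : option elt -> F), presents F c phi /\ consistent c.
Proof.
move=> /pointed_enumeration[h [hb h0 h1]]; have [g hg gh] := hb.
have hS x : h (Some x) <> hzero by rewrite -h0 => /(bij_inj hb).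
have mul_neq0 (u v : F) : u <> hzero -> v <> hzero -> u ⊙ v <> hzero.
  move=> u0 v0 uv; have [w vw] := hmul_inv v0; apply: u0.
  by rewrite -[u]hmul1 hmulC -vw hmulA uv hmul0l.
(* The multiplication of nonzero elements, pulled back along [h]; the default [gone] is never
   reached because products of nonzero elements are nonzero. *)
pose m x y := odflt gone (g (h (Some x) ⊙ h (Some y))).
have hm x y : h (Some (m x y)) = h (Some x) ⊙ h (Some y).
  rewrite /m; case E: (g _) => [z|] /=; first by rewrite -E gh.
  by case: (mul_neq0 _ _ (hS x) (hS y)); rewrite -h0 -E gh.
have hI x y : h (Some x) = h (Some y) -> x = y by move=> /(bij_inj hb)[].
have m1 : left_id gone m by move=> x; apply: hI; rewrite hm h1 hmul1.
have mC : commutative m by move=> x y; apply: hI; rewrite !hm hmulC.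
have mA : associative m by move=> x y z; apply: hI; rewrite !hm hmulA.
have mI : right_injective m.
  move=> x y z /(congr1 (h \o Some)) /=; rewrite !hm => xyz; apply: hI.
  have [w xw] := hmul_inv (hS x).
  by rewrite -[LHS]hmul1 -[RHS]hmul1 -xw [_ ⊙ w]hmulC -!hmulA xyz.
have [k [f /is_isoP[fM fI]]] := group_law_classification m m1 mC mA mI.
have f1 : f gone = gone by apply: (mI (f gone)); rewrite -fM gmul1 mC m1.
pose phi := h \o omap f.
have phib : bijective phi by apply: bij_comp => //; apply: injF_bij; apply: inj_omap.
have phi0 : phi None = hzero by [].
have phi1 : phi (Some gone) = hone by rewrite /phi /= f1.
have phiM : {morph phi : a b / mmul k a b >-> a ⊙ b}.
  move=> [x|] [y|]; rewrite /phi /= ?h0 ?hmul0l ?hmul0r //.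
  by rewrite fM hm.
have phiS x : phi (Some x) <> hzero by apply: hS.
have phiI := bij_inj phib.
have [psi phiK psiK] := phib.
have [e eE] : exists e, phi (Some e) = hopp hone.
  case E: (psi (hopp hone)) => [e|]; first by exists e; rewrite -E psiK.
  by case: (hopp1_neq0 F); rewrite -phi0 -E psiK.
have phiN x : phi (Some (gmul k e x)) = hopp (phi (Some x)).
  by rewrite hopp_mul -eE -phiM.
have ee : gmul k e e = gone.
  by apply: Some_inj; apply: phiI; rewrite phiN eE hoppK.
pose T x y := `[< zero_sum F hone (phi (Some x)) (phi (Some y)) >].
have TP x y : T x y <-> zero_sum F hone (phi (Some x)) (phi (Some y)).
  by split=> /asboolP.
have Ts x y : T x y = T y x.
  by apply/idP/idP => /TP/zero_sum_rot/zero_sumC/TP.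
have Ti x y : T x y = T (ginv k x) (gmul k (ginv k x) y).
  have iff1 : T x y <-> T (ginv k x) (gmul k (ginv k x) y).
    rewrite TP -(zero_sum_mul2l F (phi (Some (ginv k x)))) // -phi1 -!phiM /=.
    by rewrite [gmul k _ gone]gmulC [gmul k _ x]gmulC gmulV gmul1 TP zero_sumC phi1.
  by apply/idP/idP => /iff1.
pose c := Code k e (fun o =>
  if o is Some z then T gone z else T (true, false) (false, true)).
have cP : presents F c phi.
  split=> // -[x|] b d; last by rewrite phi0 hadd0 /=; split=> [/eqP ->|/phiI ->].
  case: b => [y|]; last by rewrite phi0 haddC hadd0 /=; split=> [/eqP ->|/phiI ->].
  case: d => [z|]; last first.
    by rewrite phi0 hadd_opp -phiN /=; split=> [/eqP ->|/phiI[->]].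
  (* [madd] and [zero_sum] each negate the third entry; the two signs cancel because [e] squares to
     1. *)
  have ez : gmul k e (gmul k (ginv k x) (gmul k e z)) = gmul k (ginv k x) z.
    by rewrite -[in RHS](gmul1 k z) -ee !gmulA [gmul k e (ginv k x)]gmulC.
  rewrite /madd /= -(gcls_invariant k T) // TP /zero_sum -phiN ez.
  rewrite -(hadd_mul2l F (phi (Some x))) // -phi1 -!phiM /= !gmulA gmulV !gmul1.
  by rewrite [gmul k x gone]gmulC gmul1.
exists c, phi; split=> //; have [_ _ _ _ D] := cP; apply/and3P; split.
- by rewrite /= ee.
- apply/all_eltsP => y; apply/has_oeltsP.
  have [d yd] := hadd_neq0 (phi (Some gone)) (phi (Some y)).
  by exists (psi d); apply/D; rewrite psiK.
- apply/all_eltsP => a; apply/all_eltsP => b; apply/all_oeltsP => d; apply/eqP.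
  have assoc := hadd_assoc F (phi (Some a)) (phi (Some gone)) (phi (Some b)) (phi d).
  apply/has_oeltsP/has_oeltsP => -[u /andP[/D u1 /D u2]].
    have [|v v1 v2] := assoc.1; first by exists (phi u).
    by exists (psi v); apply/andP; split; apply/D; rewrite psiK.
  have [|v v1 v2] := assoc.2; first by exists (phi u).
  by exists (psi v); apply/andP; split; apply/D; rewrite psiK.
Qed.

(** * Evaluation on the finite list, and the count *)

Lemma size_classes : size classes = 27.
Proof. by vm_compute. Qed.

(** [consistent] is a cheaper necessary condition used as a filter; the representatives it leaves
    are tested here against the full axioms. *)
Lemma classes_axioms : all hyperfield_axioms classes.
Proof. by vm_compute. Qed.

Lemma classes_complete :
  all (fun c => if consistent c then has (isomorphic c) classes else true) codes.
Proof. by vm_compute. Qed.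

Lemma all_iota (n : nat) (P : nat -> bool) :
  all P (iota 0 n) -> forall i, i < n -> P i.
Proof. by move=> /allP Pn i ltin; apply: Pn; rewrite mem_iota. Qed.

Definition nth_class (i : nat) : code := nth (Code false gone xpred0) classes i.

Lemma classes_distinct :
  all (fun i => all (fun j => isomorphic (nth_class i) (nth_class j) ==> (i == j))
    (iota 0 27)) (iota 0 27).
Proof. by vm_compute. Qed.

(** By extensionality [rel] is determined by its five values, so the 256 listed codes are all the
    codes. *)
Lemma all_codes (P : code -> bool) : all P codes -> forall c, P c.
Proof.
have mem_elts x : x \in elts by case: x => [[] []].
rewrite all_map => /allP Pcodes [k e r].
pose p := ((k, e), (r None, ((r (Some (false, false)), r (Some (false, true))),
                             (r (Some (true, false)), r (Some (true, true)))))).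
suff -> : Code k e r = code_of_bits p.
  by apply: Pcodes; do ?apply: allpairs_f; rewrite ?mem_elts // !inE; case: (X in X == _).
by congr Code; apply: funext => -[[[] []]|].
Qed.

Theorem theorem2p16 :
  exists H : 'I_27 -> hyperfield,
    [/\ forall i : 'I_27, has_order (H i) 5,
        forall i j : 'I_27, hyperfield_iso (H i) (H j) -> i = j
      & forall F : hyperfield, has_order F 5 ->
          exists i : 'I_27, hyperfield_iso F (H i)].
Proof.
have ax (i : 'I_27) : hyperfield_axioms (nth_class i).
  by apply: (all_nthP _ classes_axioms); rewrite size_classes.
exists (fun i : 'I_27 => model (nth_class i) (ax i)); split=> [i|i j|F F5].
- exact: presents_order (model_presents _ (ax i)).
- move=> /(hyperfield_iso_isomorphic _ _ _ _ _ _ (model_presents _ _) (model_presents _ _)).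
  have ij := all_iota _ _ (all_iota _ _ classes_distinct i (ltn_ord i)) j (ltn_ord j).
  by move=> iso; apply/val_inj/eqP; apply: (implyP ij).
- have [c [phi [cF cc]]] := hyperfield5_presented F F5.
  have := all_codes _ classes_complete c; rewrite cc.
  move=> /(has_nthP (Code false gone xpred0))[i].
  rewrite size_classes => ltin cisoi; exists (Ordinal ltin).
  exact: isomorphic_hyperfield_iso cF (model_presents _ _) cisoi.
Qed.
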